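(* Let $t_0\in\mathbb{R}$, let $r,\Gamma,\gamma_1,\gamma_2$ be positive constants, and let $g:[t_0-r,t_0+\Gamma)\to\mathbb{R}^+$ be a continuous function satisfying $$\mathrm{D}^+g(t)\le\gamma_1 g(t_0)+\gamma_2\|g_t\|_r\quad\text{for } t_0\le t<t_0+\Gamma.$$ Then $$g(t)\le\|g_{t_0}\|_r\,e^{\lambda(t-t_0)}\quad\text{for } t_0\le t<t_0+\Gamma,$$ where $\lambda=\gamma_1+\gamma_2$.
   Context: $\mathbb{R}^+=[0,\infty)$. $\mathrm{D}^+g(t)=\limsup_{\varepsilon\to0^+}\frac{g(t+\varepsilon)-g(t)}{\varepsilon}$ is the upper right-hand Dini derivative. For $t\in[t_0,t_0+\Gamma)$, $g_t$ is the function on $[-r,0]$ given by $g_t(s)=g(t+s)$, and $\|g_t\|_r=\sup_{s\in[-r,0]}|g(t+s)|$. *)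

(* Defs.v *)
From mathcomp Require Import all_boot all_order all_algebra.
From mathcomp Require Import all_classical all_reals all_analysis.
Set Implicit Arguments.
Unset Strict Implicit.
Unset Printing Implicit Defensive.
Import Order.TTheory GRing.Theory Num.Theory.
Import numFieldNormedType.Exports.
Local Open Scope classical_set_scope.
Local Open Scope ring_scope.

(* Extended-real valued, so that an infinite limsup is not collapsed to a
   default real value. *)
Definition upper_right_dini (R : realType) (g : R -> R) (t : R) : \bar R :=
  limf_esup (fun eps : R => ((g (t + eps) - g t) / eps)%:E) 0^'+.

(* To be used on [-r, 0]: translates of functions defined on part of R are
   represented by translates of a total extension. *)
Definition history (R : realType) (g : R -> R) (t : R) : R -> R :=
  fun s => g (t + s).

(* [sup] is the real supremum: it is the supremum in the usual sense when
   0 <= r and h is bounded on [-r, 0], in particular when h is continuous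
   there. *)
Definition history_norm (R : realType) (r : R) (h : R -> R) : R :=
  sup [set `|h s| | s in `[- r, 0]].

(* Main.v *)
Require Import Defs.
From mathcomp Require Import all_boot all_order all_algebra.
From mathcomp Require Import all_classical all_reals all_analysis.
From mathcomp Require Import ring lra.
Set Implicit Arguments.
Unset Strict Implicit.
Unset Printing Implicit Defensive.
Import Order.TTheory GRing.Theory Num.Theory.
Import numFieldNormedType.Exports.
Local Open Scope classical_set_scope.
Local Open Scope ring_scope.

(** The exponential with rate lambda = gamma1 + gamma2 solves the extremal
    equation, so it should act as a barrier for g.  The inequality obtained
    from the hypothesis at a contact point is not strict, hence the starting
    value is first inflated: for M the norm of the initial history and e > 0,
    put h x = (M + e) * exp (lambda * (x - t0)).  Let s be a point such that
    g <= h up to s and g s = h s.  As h is nondecreasing and h t0 >= M, the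
    norm of the history of g at s is at most h s, while
    g t0 <= M < M + e <= h s.  Since gamma1 > 0, the Dini derivative of g at s
    is therefore strictly smaller than lambda * h s = h' s, and g stays below
    h slightly to the right of s.  So the set of points up to which g <= h
    cannot end before the domain does ([le0_of_contact_step]).  Letting e tend
    to 0 gives the bound.

    The Dini derivative only enters through [upper_right_dini_lt], which turns
    a strict bound on it into an affine bound on g to the right of the point;
    that h lies above its tangent line is the inequality 1 + x <= exp x, so h
    is never differentiated. *)

Lemma limf_esup_lt (R : realType) (T : choiceType) (X : filteredType T)
  (f : X -> \bar R) (F : set_system X) (b : \bar R) :
  Filter F -> (limf_esup f F < b)%E -> \forall x \near F, (f x < b)%E.
Proof.
move=> FF; rewrite limf_esupE => /ereal_inf_lt[_ [V FV <-]] supVb.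
apply: filterS FV => x Vx; apply: le_lt_trans supVb.
by apply: ereal_sup_ubound; exists x.
Qed.

Lemma upper_right_dini_lt (R : realType) (g : R -> R) (t c : R) :
  (upper_right_dini g t < c%:E)%E ->
  \forall x \near t^'+, g x <= g t + c * (x - t).
Proof.
move=> /limf_esup_lt gc; apply/nbhs_right0P; near=> e.
have e_gt0 : 0 < e by [].
have : (((g (t + e) - g t) / e)%:E < c%:E)%E by near: e; exact: gc.
rewrite lte_fin ltr_pdivrMr//; lra.
Unshelve. all: by end_near. Qed.

(** Continuous induction: the supremum of the points up to which f <= 0 also
    has this property, by continuity.  Were it smaller than b, then f would
    stay nonpositive a little further, by continuity if f is negative there
    and by hypothesis if f vanishes there. *)
Lemma le0_of_contact_step (R : realType) (f : R -> R) (a b : R) :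
  a <= b -> f a <= 0 ->
  (forall s, a <= s <= b -> {for s, continuous f}) ->
  (forall s, a <= s < b -> (forall v, a <= v <= s -> f v <= 0) -> f s = 0 ->
    \forall x \near s^'+, f x <= 0) ->
  f b <= 0.
Proof.
move=> ab fa cf step.
pose S := [set u | a <= u <= b /\ forall v, a <= v <= u -> f v <= 0].
have Sa : S a.
  by split=> [|v av]; [rewrite lexx|rewrite (_ : v = a)//; lra].
have ubS : has_ubound S by exists b => u [/andP[]].
have supS : has_sup S by split=> //; exists a.
set s := sup S.
have as_ : a <= s by exact: ub_le_sup.
have sb : s <= b by apply: ge_sup; [exists a|move=> u [/andP[]]].
have cfs : {for s, continuous f} by apply: cf; rewrite as_.
have fs : f s <= 0.
  rewrite leNgt; apply/negP => fs_gt0.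
  have /nbhs_ballP[e /= e_gt0 fe] : \forall x \near s, 0 < f x.
    exact: cvgr_gt cfs _ fs_gt0.
  have [u [/andP[au ub] fu] su] := sup_adherent e_gt0 supS.
  have us : u <= s by apply: ub_le_sup => //; split=> //; rewrite au.
  have : 0 < f u by apply: fe; rewrite /ball/= ger0_norm -/s in su *; lra.
  by rewrite ltNge fu// au lexx.
have fS v : a <= v <= s -> f v <= 0.
  move=> /andP[av]; rewrite le_eqVlt => /predU1P[->//|vs].
  have [u [_ fu] vu] := sup_gt (ex_intro _ a Sa) vs.
  by apply: fu; rewrite av ltW.
have [sltb|] := ltP s b; last by move=> bs; apply: fS; rewrite ab.
have : \forall x \near s^'+, f x <= 0.
  move: fs; rewrite le_eqVlt => /predU1P[fs0|fs_lt0].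
    by apply: step => //; rewrite as_.
  have fneg : \forall x \near s, f x < 0 by exact: cvgr_lt cfs _ fs_lt0.
  by rewrite near_withinE; apply: filterS fneg => x /ltW.
rewrite near_withinE => /nbhs_ballP[e /= e_gt0 fe].
pose u := Num.min b (s + e / 2).
have su : s < u by rewrite lt_min sltb ltrDl divr_gt0.
have ub : u <= b by rewrite ge_min lexx.
have use : u <= s + e / 2 by rewrite ge_min lexx orbT.
suff : u <= s by rewrite leNgt su.
apply: ub_le_sup => //; split=> [|v /andP[av vu]].
  by rewrite ub (le_trans as_ (ltW su)).
have [vs|sv] := leP v s; first by apply: fS; rewrite av.
by apply: fe => //; rewrite /ball/= ltr0_norm; lra.
Qed.

Lemma history_norm_le (R : realType) (r t c : R) (g : R -> R) :
  0 <= r -> (forall x, t - r <= x <= t -> `|g x| <= c) ->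
  history_norm r (history g t) <= c.
Proof.
move=> r_ge0 gc; apply: ge_sup.
  by exists `|g (t + 0)|, 0 => //=; rewrite in_itv/= lexx oppr_le0 r_ge0.
by move=> _ [x /=] + <-; rewrite in_itv/= => ?; apply: gc; lra.
Qed.

(** The supremum defining the norm is a genuine one here, since a continuous
    function is bounded on a compact interval. *)
Lemma le_history_norm (R : realType) (r t : R) (g : R -> R) :
  0 <= r -> {within `[t - r, t], continuous g} ->
  forall x, t - r <= x <= t -> `|g x| <= history_norm r (history g t).
Proof.
move=> r_ge0 cg x xt.
have cng : {within `[t - r, t], continuous (fun x => `|g x|)}.
  by apply: (@within_continuous_comp _ _ _ _ g (@Num.norm _ _)) => // y _;
    exact: norm_continuous.
have [c _ maxc] := EVT_max (ltac:(lra) : t - r <= t) cng.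
apply: ub_le_sup.
  exists `|g c| => _ [y /=] + <-; rewrite in_itv/= => ?.
  by apply: maxc; rewrite in_itv/=; lra.
exists (x - t); first by rewrite /= in_itv/=; lra.
by rewrite /history addrC subrK.
Qed.

Theorem lemma2 (R : realType) (t0 r Gamma gamma1 gamma2 : R) (g : R -> R)
  (r_gt0 : 0 < r) (Gamma_gt0 : 0 < Gamma)
  (gamma1_gt0 : 0 < gamma1) (gamma2_gt0 : 0 < gamma2)
  (g_ge0 : forall t : R, t0 - r <= t < t0 + Gamma -> 0 <= g t)
  (g_cont : {within `[t0 - r, t0 + Gamma[, continuous g})
  (g_dini : forall t : R, t0 <= t < t0 + Gamma ->
    (upper_right_dini g t <=
      (gamma1 * g t0 + gamma2 * history_norm r (history g t))%:E)%E) :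
  let lambda := gamma1 + gamma2 in
  forall t : R, t0 <= t < t0 + Gamma ->
    g t <= history_norm r (history g t0) * expR (lambda * (t - t0)).
Proof.
move=> lambda t /andP[t0t tG].
set M := history_norm r (history g t0).
have gM x : t0 - r <= x <= t0 -> `|g x| <= M.
  apply: le_history_norm; first exact: ltW.
  apply: continuous_subspaceW g_cont => y /=; rewrite !in_itv/=; lra.
have gt0M : g t0 <= M by apply: le_trans (ler_norm _) (gM _ _); lra.
have cg s : t0 <= s <= t -> {for s, continuous g}.
  move=> /andP[t0s st].
  apply: (@within_continuous_continuous _ _ _ (t0 - r) ((t + t0 + Gamma) / 2)).
  - lra.
  - by apply: continuous_subspaceW g_cont => y /=; rewrite !in_itv/=; lra.
  - by rewrite in_itv/=; lra.
have lambda_gt0 : 0 < lambda by exact: addr_gt0.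
suff ge e : 0 < e -> g t <= (M + e) * expR (lambda * (t - t0)).
  rewrite -ler_pdivrMr ?expR_gt0//; apply/ler_addgt0Pr => e /ge.
  by rewrite -ler_pdivrMr ?expR_gt0.
move=> e_gt0; pose h x := (M + e) * expR (lambda * (x - t0)).
have M_ge0 : 0 <= M by apply: le_trans (gM t0 _); [exact: normr_ge0|lra].
have Me_gt0 : 0 < M + e by lra.
have h_gt0 x : 0 < h x by rewrite mulr_gt0 ?expR_gt0.
have h_nd x y : x <= y -> h x <= h y.
  by move=> xy; rewrite ler_pM2l// ler_expR ler_pM2l//; lra.
have h_t0 : h t0 = M + e by rewrite /h subrr mulr0 expR0 mulr1.
have h_tangent x y : h x + lambda * h x * (y - x) <= h y.
  rewrite [leRHS](_ : _ = h x * expR (lambda * (y - x))); last first.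
    by rewrite /h -mulrA -expRD; congr (_ * expR _); ring.
  rewrite [leLHS](_ : _ = h x * (1 + lambda * (y - x))); last by ring.
  by rewrite ler_pM2l// expR_ge1Dx.
suff : g t - h t <= 0 by rewrite subr_le0.
apply: (@le0_of_contact_step _ (fun x => g x - h x) t0 t) => //.
- by rewrite h_t0; lra.
- move=> s /cg cgs; apply: cvgB => //.
  apply: cvgM; first exact: cvg_cst.
  apply: (@continuous_comp _ _ _ (fun x => lambda * (x - t0)) expR).
    by apply: cvgM; [exact: cvg_cst|apply: cvgB; [exact: cvg_id|exact: cvg_cst]].
  exact: continuous_expR.
move=> s /andP[t0s st] gh /eqP; rewrite subr_eq0 => /eqP gsE.
have norm_s : history_norm r (history g s) <= h s.
  apply: history_norm_le => [|x /andP[rx xs]]; first exact: ltW.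
  have [t0x|xt0] := leP t0 x.
    rewrite ger0_norm; last by apply: g_ge0; lra.
    have := gh x; rewrite t0x xs subr_le0 => /(_ isT) /le_trans; apply.
    exact: h_nd.
  apply: le_trans (gM x _) _; first lra.
  by apply: le_trans (h_nd _ _ t0s); rewrite h_t0; lra.
have dini_lt : (upper_right_dini g s < (lambda * h s)%:E)%E.
  apply: le_lt_trans (g_dini s _) _; first lra.
  rewrite lte_fin /lambda mulrDl ltr_leD// ?ler_pM2l// ltr_pM2l//.
  by have := h_nd _ _ t0s; lra.
apply: filterS (upper_right_dini_lt dini_lt) => x.
by rewrite gsE subr_le0 => /le_trans; apply; exact: h_tangent.
Qed.
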